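(* Let $\epsilon_1$ and $\epsilon_2$ be arbitrary positive bounded confidence levels. Then the distribution $$f^\infty(\mathbf{x},\mathbf{c})=\sum_{k=1}^{n_1}f_k\,\delta(\mathbf{x}-\mathbf{x}_k)\sum_{\ell=1}^{n_2(k)}\delta(\mathbf{c}-\mathbf{c}_{k_\ell})$$ with $f_k>0$ and $\sum_{k=1}^{n_1}\sum_{\ell=1}^{n_2(k)}f_k=1$ is a weak stationary solution of the mean-field equation $\partial_t f+\nabla_{\mathbf{x}}\cdot(\mathbf{V}_{\epsilon_1,\epsilon_2}f)=0$ if and only if either $$\|\mathbf{x}_i-\mathbf{x}_k\|_{\mathbb{R}^{d_1}}>\epsilon_1\quad\text{for all } i\neq k,$$ or $$\|\mathbf{c}_{i_j}-\mathbf{c}_{k_\ell}\|_{\mathbb{R}^{d_2}}>\epsilon_2\quad\text{for all } i\neq k,\ \text{for all } j,\ell,$$ or both hold true.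
   Context: Let $\Omega_1\subseteq\mathbb{R}^{d_1}$ and $\Omega_2\subseteq\mathbb{R}^{d_2}$ be compact domains, $\Omega=\Omega_1\times\Omega_2$, and fix norms $\|\cdot\|_{\mathbb{R}^{d_1}}$, $\|\cdot\|_{\mathbb{R}^{d_2}}$. Here $n_1\ge1$ and $n_2(k)\ge1$ are integers, $\mathbf{x}_k\in\Omega_1$ for $k=1,\dots,n_1$, and $\mathbf{c}_{k_\ell}\in\Omega_2$ for $\ell=1,\dots,n_2(k)$; the indices $i,k$ range over $\{1,\dots,n_1\}$, $j$ over $\{1,\dots,n_2(i)\}$ and $\ell$ over $\{1,\dots,n_2(k)\}$. For $\epsilon\ge0$ let $\chi_\epsilon(r)=1$ if $r\le\epsilon$ and $\chi_\epsilon(r)=0$ otherwise. The velocity field associated with a distribution $f$ on $\Omega$ is $$\mathbf{V}_{\epsilon_1,\epsilon_2}(t,\mathbf{x},\mathbf{c})=\int_\Omega \frac{\chi_{\epsilon_1}(\|\mathbf{y}-\mathbf{x}\|_{\mathbb{R}^{d_1}})\,\chi_{\epsilon_2}(\|\mathbf{z}-\mathbf{c}\|_{\mathbb{R}^{d_2}})}{\sigma(t,\mathbf{x},\mathbf{c})}\,(\mathbf{y}-\mathbf{x})\,f(t,\mathbf{y},\mathbf{z})\,\mathrm{d}\mathbf{z}\,\mathrm{d}\mathbf{y},$$ where either $\sigma\equiv1$ (symmetric interactions) or $\sigma(t,\mathbf{x},\mathbf{c})=\int_\Omega\chi_{\epsilon_1}(\|\mathbf{y}-\mathbf{x}\|_{\mathbb{R}^{d_1}})\chi_{\epsilon_2}(\|\mathbf{z}-\mathbf{c}\|_{\mathbb{R}^{d_2}})f(t,\mathbf{y},\mathbf{z})\,\mathrm{d}\mathbf{z}\,\mathrm{d}\mathbf{y}$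 (non-symmetric interactions). A time-independent distribution $f^\infty$ is a weak stationary solution if, with $\mathbf{V}_{\epsilon_1,\epsilon_2}$ computed from $f=f^\infty$, one has $$\int_\Omega\varphi(\mathbf{x},\mathbf{c})\,\nabla_{\mathbf{x}}\cdot\left(\mathbf{V}_{\epsilon_1,\epsilon_2}(t,\mathbf{x},\mathbf{c})f^\infty(\mathbf{x},\mathbf{c})\right)\mathrm{d}\mathbf{x}\,\mathrm{d}\mathbf{c}=0$$ for all test functions $\varphi\in C^1_0(\Omega)$ (continuous and compactly supported functions on $\Omega$ with continuous derivative), the left-hand side being understood after integration by parts as $-\int_\Omega \mathbf{V}_{\epsilon_1,\epsilon_2}\cdot\nabla_{\mathbf{x}}\varphi\,f^\infty\,\mathrm{d}\mathbf{x}\,\mathrm{d}\mathbf{c}$.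
   Formalization: The ''either/or'' is taken separately for each pair i≠k (with all j,ℓ), since as a choice made once for all pairs the ''only if'' fails for three clusters; the x_k are assumed pairwise distinct; test functions on compact Ω need not vanish on its boundary. *)

(* Defs.v *)
From HB Require Import structures.
From mathcomp Require Import all_boot all_order all_algebra.
From mathcomp Require Import all_classical all_reals all_analysis.

Set Implicit Arguments.
Unset Strict Implicit.
Unset Printing Implicit Defensive.

Import Order.TTheory GRing.Theory Num.Theory.
Import numFieldNormedType.Exports.

Local Open Scope classical_set_scope.
Local Open Scope ring_scope.

(* An arbitrary norm on R^d; the norm `|_| carried by 'rV[R]_d is the sup norm
   and only serves to fix the topology. *)
Definition is_norm (R : realType) (d : nat) (N : 'rV[R]_d -> R) : Prop :=
  [/\ forall v, N v = 0 -> v = 0,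
      forall a v, N (a *: v) = `|a| * N v
    & forall v w, N (v + w) <= N v + N w].

(* R^d1 x R^d2 with its Borel sigma-algebra *)
Definition phase (R : realType) (d1 d2 : nat) :=
  g_sigma_algebraType (@open ('rV[R]_d1 * 'rV[R]_d2)%type).

Definition point_of (R : realType) (d1 d2 : nat) (x : 'rV[R]_d1)
  (c : 'rV[R]_d2) : phase R d1 d2 := (x, c).

Definition chi (R : realType) (eps r : R) : R := if r <= eps then 1 else 0.

Variant interaction := Symmetric | NonSymmetric.

Section mean_field.
Context (R : realType) (d1 d2 : nat).
Variables (Omega : set ('rV[R]_d1 * 'rV[R]_d2)).
Variables (N1 : 'rV[R]_d1 -> R) (N2 : 'rV[R]_d2 -> R) (eps1 eps2 : R).
Variables (mode : interaction) (mu : {measure set (phase R d1 d2) -> \bar R}).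

Definition kernel (x : 'rV[R]_d1) (c : 'rV[R]_d2) (q : phase R d1 d2) : R :=
  chi eps1 (N1 (q.1 - x)) * chi eps2 (N2 (q.2 - c)).

Definition sigma (x : 'rV[R]_d1) (c : 'rV[R]_d2) : R :=
  match mode with
  | Symmetric => 1
  | NonSymmetric => \int[mu]_(q in Omega) kernel x c q
  end.

(* The integral is taken coordinatewise.  In the non-symmetric case sigma can
   vanish only where V is multiplied by mu = 0; division by 0 then gives 0. *)
Definition velocity (x : 'rV[R]_d1) (c : 'rV[R]_d2) : 'rV[R]_d1 :=
  \row_(i < d1)
    \int[mu]_(q in Omega) (kernel x c q / sigma x c * (q.1 - x) ord0 i).

Definition grad_x (phi : 'rV[R]_d1 * 'rV[R]_d2 -> R)
    (p : 'rV[R]_d1 * 'rV[R]_d2) : 'rV[R]_d1 :=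
  \row_(i < d1) 'D_(delta_mx ord0 i, 0) phi p.

Definition C1 (phi : 'rV[R]_d1 * 'rV[R]_d2 -> R) : Prop :=
  (forall p, differentiable phi p) /\ (forall v, continuous ('D_v phi)).

(* C^1_0(Omega): restrictions to Omega of C^1 functions, with compact support
   relative to Omega.  Omega being compact and containing its boundary, phi
   need not vanish on that boundary, so that particles located there are seen
   by the test functions. *)
Definition test_function (phi : 'rV[R]_d1 * 'rV[R]_d2 -> R) : Prop :=
  C1 phi /\ compact (closure (Omega `&` [set p | phi p != 0])).

Definition weak_stationary : Prop :=
  forall phi, test_function phi ->
    - (\int[mu]_(p in Omega)
         \sum_(i < d1) velocity p.1 p.2 ord0 i * grad_x phi p ord0 i) = 0.

End mean_field.

Section finite_sum_of_measures.
Local Open Scope ereal_scope.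
Context (d : measure_display) (T : measurableType d) (R : realType).
Variables (I : finType) (m : I -> {measure set T -> \bar R}).

Definition fin_msum (A : set T) : \bar R := \sum_(i : I) m i A.

Let fin_msum0 : fin_msum set0 = 0.
Proof. by rewrite /fin_msum big1. Qed.

Let fin_msum_ge0 A : 0 <= fin_msum A.
Proof. by rewrite /fin_msum; apply: sume_ge0. Qed.

Let fin_msum_sigma_additive : semi_sigma_additive fin_msum.
Proof.
move=> F mF tF mUF; rewrite [X in _ --> X](_ : _ =
  lim ((fun n => \sum_(0 <= i < n) fin_msum (F i)) @ \oo)).
  by apply: is_cvg_ereal_nneg_natsum => k _; exact: fin_msum_ge0.
rewrite nneseries_sum//; apply: eq_bigr => i _.
by rewrite measure_bigcup//; apply: eq_eseriesl => k; rewrite in_setT.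
Qed.

HB.instance Definition _ := isMeasure.Build _ _ _ fin_msum
  fin_msum0 fin_msum_ge0 fin_msum_sigma_additive.

End finite_sum_of_measures.

(* sum_k f_k delta(x - x_k) sum_l delta(c - c_{k_l}) *)
Definition opinion_clusters (R : realType) (d1 d2 n1 : nat) (n2 : 'I_n1 -> nat)
    (x : 'I_n1 -> 'rV[R]_d1) (c : forall k : 'I_n1, 'I_(n2 k) -> 'rV[R]_d2)
    (f : 'I_n1 -> {posnum R}) : {measure set (phase R d1 d2) -> \bar R} :=
  fin_msum (fun k : 'I_n1 =>
    mscale ((f k)%:num%:nng)
      (fin_msum (fun l : 'I_(n2 k) => \d_(point_of (x k) (c k l))))).

(* Main.v *)
Require Import Defs.
From HB Require Import structures.
From mathcomp Require Import all_boot all_order all_algebra.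
From mathcomp Require Import all_classical all_reals all_analysis.
From mathcomp Require Import measurable_realfun.
From mathcomp Require Import ring lra.

Import Order.TTheory GRing.Theory Num.Theory.
Import numFieldNormedType.Exports.

Local Open Scope classical_set_scope.
Local Open Scope ring_scope.

(** The measure is a finite sum of weighted Dirac masses, so every integral over
    Omega is a finite sum over particles [t] of weight [w t] and position
    [pt t] ([Rintegral_atomic]).  The weak equation becomes
    [\sum_t w t * (V (pt t) . grad_x phi (pt t)) = 0] for every C^1 function
    [phi] ([weak_stationary_atomicE]); as Omega is compact, every C^1 function
    is a test function.

    If no two particles with different opinions interact, each term of
    each velocity vanishes, either through the kernel or through the
    displacement [y - x], and the equation holds trivially.

    Conversely, [grad_x phi] can be prescribed at one position and annihilated
    at all the others by a polynomial ([grad_x_interpolation]).  Prescribing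
    the velocity itself gives a sum of squares equal to zero, so the velocity
    vanishes at each particle ([velocity_eq0_of_stationary]).  The
    normalisation sigma is positive at a particle, which interacts with itself,
    so it cancels and both interaction modes lead to the same balance
    [\sum_b w b * K a b * (x b - x a) = 0] for each [a], with a symmetric
    kernel [K].  Pairing this balance with [w a * x a] and summing over [a]
    gives [\sum_a \sum_b w a * w b * K a b * (x b - x a) ^+ 2 = 0] after
    symmetrisation ([energy_dissipation]); hence two particles
    that interact share the same opinion.  The theorem is this
    characterization ([weak_stationary_atomicP]) read on the clusters, whose
    opinions [x k] are pairwise distinct.

    To evaluate an integral against Dirac masses the integrand must be
    measurable: this uses that an arbitrary norm on a finite-dimensional space
    is continuous ([is_norm_continuous]), which makes the confidence kernel,
    and then the velocity field, Borel functions. *)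

(** * Norms on a finite-dimensional space *)

Lemma lipschitz_bound_continuous {R : realType} {V : normedModType R}
    (g : V -> R) (M : R) :
  0 <= M -> (forall u v, `|g u - g v| <= M * `|u - v|) -> continuous g.
Proof.
move=> M0 gM v; apply/cvgrPdist_lt => e e0.
have M1 : 0 < M + 1 by rewrite ltr_wpDl.
apply/nbhs_normP; exists (e / (M + 1)); first by rewrite /= divr_gt0.
move=> u /= vu; apply: (le_lt_trans (gM _ _)).
apply: (@le_lt_trans _ _ ((M + 1) * `|v - u|)); first by rewrite ler_wpM2r// lerDl.
by rewrite -ltr_pdivlMl// mulrC.
Qed.

Section Norms.
Context {R : realType} {d : nat} {N : 'rV[R]_d -> R}.
Hypothesis normN : is_norm N.

Lemma is_norm0 : N 0 = 0.
Proof. by case: normN => _ NZ _; rewrite -(scale0r (0 : 'rV[R]_d)) NZ normr0 mul0r. Qed.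

Lemma is_normN v : N (- v) = N v.
Proof. by case: normN => _ NZ _; rewrite -scaleN1r NZ normrN1 mul1r. Qed.

Lemma is_norm_distC v w : N (v - w) = N (w - v).
Proof. by rewrite -opprB is_normN. Qed.

Lemma is_norm_sum (I : finType) (F : I -> 'rV[R]_d) :
  N (\sum_i F i) <= \sum_i N (F i).
Proof.
case: normN => _ _ NT; elim/big_ind2 : _ => [|u a v b ua vb|//].
  by rewrite is_norm0.
exact: le_trans (NT _ _) (lerD ua vb).
Qed.

(** All norms are dominated by the sup norm: expanding [v] in the canonical
    basis gives [N v <= M * `|v|] with [M] the sum of the norms of the basis
    vectors, and the triangle inequality makes [N] Lipschitz. *)
Lemma is_norm_continuous : continuous N.
Proof.
case: (normN) => _ NZ NT.
pose M := \sum_(i < d) N (delta_mx ord0 i).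
have N_ge0 u : 0 <= N u.
  have := NT u (- u); rewrite subrr is_norm0 is_normN -mulr2n.
  by rewrite pmulrn_lge0.
have M_ge0 : 0 <= M by apply: sumr_ge0.
have NM u : N u <= M * `|u|.
  rewrite {1}(row_sum_delta u); apply: (le_trans (is_norm_sum _ _)).
  rewrite mulr_suml; apply: ler_sum => i _; rewrite NZ mulrC ler_wpM2l//.
  exact: (le_bigmax _ (fun ij => `|u ij.1 ij.2|%:nng) (ord0, i)).
apply: (@lipschitz_bound_continuous _ _ N M) => // u w.
have uw a b : N a - N b <= M * `|a - b|.
  apply: (le_trans _ (NM _)); rewrite lerBlDl.
  by apply: (le_trans _ (NT _ _)); rewrite subrKC.
by rewrite ler_norml lerNl opprB [in X in X && _]distrC !uw.
Qed.

End Norms.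

(** * Borel measurability on the phase space *)

Section BorelPhase.
Context {R : realType} {d1 d2 : nat}.
Local Notation P := (phase R d1 d2).

Lemma open_phase_measurable (A : set P) :
  @open ('rV[R]_d1 * 'rV[R]_d2)%type A -> measurable A.
Proof. exact: sub_sigma_algebra. Qed.

Lemma compact_phase_measurable (A : set P) :
  @compact ('rV[R]_d1 * 'rV[R]_d2)%type A -> measurable A.
Proof.
move=> cA; rewrite -(setCK A); apply: measurableC; apply: open_phase_measurable.
apply: closed_openC; apply: compact_closed cA.
exact: (@norm_hausdorff R ('rV[R]_d1 * 'rV[R]_d2)%type).
Qed.

Lemma continuous_phase_measurable (g : P -> R) :
  continuous (g : 'rV[R]_d1 * 'rV[R]_d2 -> R) -> measurable_fun setT g.
Proof.
move=> /continuousP cg; apply: (measurability _ (RGenOpens.measurableE R)).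
move=> _ [_ [a [b ->] <-]]; rewrite setTI; apply: open_phase_measurable.
exact/cg/interval_open.
Qed.

Lemma measurable_coord1 i : measurable_fun setT (fun q : P => q.1 ord0 i).
Proof.
apply: continuous_phase_measurable => q.
apply: (@continuous_comp _ _ _ fst (fun M : 'rV[R]_d1 => M ord0 i)).
  exact: cvg_fst.
exact: coord_continuous.
Qed.

Lemma measurable_chi (eps : R) (g : P -> R) :
  measurable_fun setT g -> measurable_fun setT (fun q => chi eps (g q)).
Proof.
move=> mg; apply: measurable_fun_ifT => //.
by apply: measurable_fun_ler => //; exact: measurable_cst.
Qed.

(** Inversion is continuous away from 0, and every function is measurable on a
    singleton. *)
Lemma measurable_invr : measurable_fun setT (fun r : R => r^-1).
Proof.
have -> : [set: R] = [set 0] `|` [set~ 0] by rewrite setUv.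
apply/measurable_funU => //; first exact: measurableC.
split; first exact: measurable_fun_set1.
apply: open_continuous_measurable_fun => [|r].
  by apply: closed_openC; exact: closed_eq.
by rewrite inE/= => /eqP r0; exact: inv_continuous.
Qed.

Lemma measurable_confidence_kernel (N1 : 'rV[R]_d1 -> R) (N2 : 'rV[R]_d2 -> R) eps1 eps2 :
  is_norm N1 -> is_norm N2 ->
  forall x c, measurable_fun setT (Defs.kernel N1 N2 eps1 eps2 x c).
Proof.
move=> norm1 norm2 x c; apply: measurable_funM; apply: measurable_chi;
  apply: continuous_phase_measurable.
- have c1 : continuous (fun q : 'rV[R]_d1 * 'rV[R]_d2 => q.1 - x).
    by move=> q; apply: continuousB; [exact: cvg_fst|exact: cvg_cst].
  by move=> q; exact: (continuous_comp (c1 q) (is_norm_continuous norm1 _)).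
- have c2 : continuous (fun q : 'rV[R]_d1 * 'rV[R]_d2 => q.2 - c).
    by move=> q; apply: continuousB; [exact: cvg_snd|exact: cvg_cst].
  by move=> q; exact: (continuous_comp (c2 q) (is_norm_continuous norm2 _)).
Qed.

Lemma confidence_kernelC (N1 : 'rV[R]_d1 -> R) (N2 : 'rV[R]_d2 -> R) eps1 eps2 (p q : P) :
  is_norm N1 -> is_norm N2 ->
  Defs.kernel N1 N2 eps1 eps2 p.1 p.2 q = Defs.kernel N1 N2 eps1 eps2 q.1 q.2 p.
Proof.
by move=> n1 n2; rewrite /Defs.kernel (is_norm_distC n1) (is_norm_distC n2).
Qed.

End BorelPhase.

(** * Integration against finite sums of Dirac masses *)

Section AtomicMeasures.
Context {disp : measure_display} {T : measurableType disp} {R : realType}.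
Context {I : finType} (w : I -> {posnum R}) (pt : I -> T).
Variable mu : {measure set T -> \bar R}.
Hypothesis muE : forall A, measurable A ->
  mu A = (\sum_i (w i)%:num%:E * \d_(pt i) A)%E.

(* The theorem on integrals against finite sums of measures takes families
   indexed by nat: the atoms are enumerated, and padded with the null measure. *)
Let atom (n : nat) : {measure set T -> \bar R} :=
  if insub n is Some j then
    mscale ((w (enum_val (j : 'I_#|I|)))%:num%:nng) \d_(pt (enum_val j))
  else mzero.

Lemma ge0_integral_atomic (D : set T) (g : T -> \bar R) :
  measurable D -> (forall i, D (pt i)) -> measurable_fun D g ->
  (forall q, D q -> 0 <= g q)%E ->
  (\int[mu]_(q in D) g q = \sum_i (w i)%:num%:E * g (pt i))%E.
Proof.
move=> mD Dpt mg g0.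
transitivity (\int[msum atom #|I|]_(q in D) g q)%E.
  apply: eq_measure_integral => A mA _; rewrite muE// /msum/=.
  rewrite (reindex _ (onW_bij _ (enum_val_bij I)))/=.
  by apply: eq_bigr => j _; rewrite /atom valK.
rewrite ge0_integral_measure_sum// (reindex _ (onW_bij _ (enum_val_bij I)))/=.
apply: eq_bigr => j _; rewrite /atom valK ge0_integral_mscale//.
by rewrite integral_dirac// diracE mem_set ?mul1e.
Qed.

(** The nonnegative case applies to the positive and to the negative part, and
    the two finite sums so obtained can be subtracted. *)
Lemma Rintegral_atomic (D : set T) (g : T -> R) :
  measurable D -> (forall i, D (pt i)) -> measurable_fun D g ->
  \int[mu]_(q in D) g q = \sum_i (w i)%:num * g (pt i).
Proof.
move=> mD Dpt mg; have mEg : measurable_fun D (EFin \o g) by exact/measurable_EFinP.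
rewrite /Rintegral integralE !ge0_integral_atomic//.
- under eq_bigr do rewrite funeposE /= -EFin_max -EFinM.
  under [X in (_ - X)%E]eq_bigr do rewrite funenegE /= -EFin_max -EFinM.
  rewrite !sumEFin -EFinB /= -sumrB; apply: eq_bigr => i _; rewrite -mulrBr.
  by congr (_ * _); rewrite /Num.max; case: ltP => ?; case: ltP => ?; lra.
- exact/measurable_funeneg.
- exact/measurable_funepos.
Qed.

End AtomicMeasures.

(** The particles of all the clusters form a single finite type, the dependent
    pairs of a cluster and of one of its members.  Members of the same cluster
    may sit at the same position. *)
Section Clusters.
Context {R : realType} {d1 d2 n1 : nat} {n2 : 'I_n1 -> nat}.
Variables (x : 'I_n1 -> 'rV[R]_d1) (c : forall k : 'I_n1, 'I_(n2 k) -> 'rV[R]_d2).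
Variable f : 'I_n1 -> {posnum R}.

Local Notation particle := {k : 'I_n1 & 'I_(n2 k)}.

Definition position (t : particle) : phase R d1 d2 :=
  point_of (x (tag t)) (c (tag t) (tagged t)).

Lemma opinion_clustersE (A : set (phase R d1 d2)) :
  (opinion_clusters x c f A =
   \sum_(t : particle) (f (tag t))%:num%:E * \d_(position t) A)%E.
Proof.
transitivity (\sum_(k < n1) \sum_(l < n2 k)
    ((f k)%:num%:E * \d_(point_of (x k) (c k l)) A))%E.
  rewrite /opinion_clusters /= /fin_msum; apply: eq_bigr => k _.
  rewrite -[LHS]/(((f k)%:num)%:E * \sum_(l < n2 k) \d_(point_of (x k) (c k l)) A)%E.
  by rewrite ge0_sume_distrr.
exact: (@sig_big_dep _ 0%E (+%R : Monoid.com_law 0%E) 'I_n1 (fun k => 'I_(n2 k))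
  xpredT (fun _ => xpredT)
  (fun k l => ((f k)%:num%:E * \d_(point_of (x k) (c k l)) A)%E)).
Qed.

End Clusters.

(** * C^1 functions and interpolation of gradients *)

Section C1Functions.
Context {R : realType} {d1 d2 : nat}.
Local Notation V := ('rV[R]_d1 * 'rV[R]_d2)%type.

Lemma C1_derivable (g : V -> R) p v (gC : C1 g) : derivable g p v.
Proof. by case: gC => dg _; exact: diff_derivable. Qed.

Lemma C1_continuous (g : V -> R) : C1 g -> continuous g.
Proof. by case=> dg _ p; exact: differentiable_continuous. Qed.

Lemma C1_cst (k : R) : C1 (cst k : V -> R).
Proof.
split=> [p|v]; first exact: differentiable_cst.
rewrite (_ : 'D_v _ = cst 0); first by move=> p; exact: cst_continuous.
by apply/funext => p; rewrite derive_cst.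
Qed.

Lemma C1D (g h : V -> R) : C1 g -> C1 h -> C1 (g + h).
Proof.
move=> gC hC; split=> [p|v].
  by apply: differentiableD; [exact: gC.1|exact: hC.1].
rewrite (_ : 'D_v _ = fun p => 'D_v g p + 'D_v h p).
  by move=> p; exact: (cvgD (gC.2 v p) (hC.2 v p)).
by apply/funext => p; exact: deriveD (C1_derivable _ p v gC) (C1_derivable _ p v hC).
Qed.

Lemma C1M (g h : V -> R) : C1 g -> C1 h -> C1 (g * h).
Proof.
move=> gC hC; split=> [p|v].
  by apply: differentiableM; [exact: gC.1|exact: hC.1].
rewrite (_ : 'D_v _ = fun p => g p * 'D_v h p + h p * 'D_v g p).
  move=> p; exact: (cvgD (cvgM (C1_continuous _ gC p) (hC.2 v p))
                         (cvgM (C1_continuous _ hC p) (gC.2 v p))).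
by apply/funext => p; exact: deriveM (C1_derivable _ p v gC) (C1_derivable _ p v hC).
Qed.

Lemma C1_sum (I : Type) (s : seq I) (P : pred I) (g : I -> V -> R) :
  (forall i, C1 (g i)) -> C1 (\sum_(i <- s | P i) g i).
Proof.
by move=> gC; elim/big_ind : _ => // [|u v]; [exact: C1_cst|exact: C1D].
Qed.

Lemma C1_prod (I : Type) (s : seq I) (P : pred I) (g : I -> V -> R) :
  (forall i, C1 (g i)) -> C1 (\prod_(i <- s | P i) g i).
Proof.
by move=> gC; elim/big_ind : _ => // [|u v]; [exact: C1_cst|exact: C1M].
Qed.

Lemma C1_linear (g : V -> R) : linear g -> continuous g ->
  C1 g /\ forall v p, 'D_v g p = g v.
Proof.
move=> glin gc; pose gM := GRing.isLinear.Build _ _ _ _ _ glin.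
pose gL : {linear V -> R} := HB.pack g gM.
have dg p : differentiable g p by exact: (@linear_differentiable _ _ _ gL).
have Dg v p : 'D_v g p = g v by rewrite deriveE// (@diff_lin _ _ _ gL).
split=> //; split=> // v; rewrite (_ : 'D_v g = cst (g v)).
  by move=> p; exact: cst_continuous.
by apply/funext => p; rewrite Dg.
Qed.

(** [xshift], [cshift] and [sqdist] are written with the operations of the ring
    of functions, so that [C1D], [C1M] and the rules of derivation apply as they
    stand. *)
Definition xshift (b : V) i : V -> R :=
  (fun p : V => p.1 ord0 i) + (cst (- b.1 ord0 i) : V -> R).

Definition cshift (b : V) j : V -> R :=
  (fun p : V => p.2 ord0 j) + (cst (- b.2 ord0 j) : V -> R).

Lemma C1_xcoord i : C1 (fun p : V => p.1 ord0 i) /\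
  forall v p, 'D_v (fun p : V => p.1 ord0 i) p = v.1 ord0 i.
Proof.
apply: C1_linear => [k u v|p]; first by rewrite /= !mxE.
apply: (@continuous_comp _ _ _ fst (fun M : 'rV[R]_d1 => M ord0 i)).
  exact: cvg_fst.
exact: coord_continuous.
Qed.

Lemma C1_ccoord j : C1 (fun p : V => p.2 ord0 j) /\
  forall v p, 'D_v (fun p : V => p.2 ord0 j) p = v.2 ord0 j.
Proof.
apply: C1_linear => [k u v|p]; first by rewrite /= !mxE.
apply: (@continuous_comp _ _ _ snd (fun M : 'rV[R]_d2 => M ord0 j)).
  exact: cvg_snd.
exact: coord_continuous.
Qed.

Lemma C1_xshift b i : C1 (xshift b i).
Proof. by apply: C1D; [exact: (C1_xcoord i).1|exact: C1_cst]. Qed.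

Lemma C1_cshift b j : C1 (cshift b j).
Proof. by apply: C1D; [exact: (C1_ccoord j).1|exact: C1_cst]. Qed.

Lemma derive_xshift b i v p : 'D_v (xshift b i) p = v.1 ord0 i.
Proof.
rewrite [LHS](deriveD (C1_derivable _ p v (C1_xcoord i).1)
                      (C1_derivable _ p v (C1_cst _))).
by rewrite (C1_xcoord i).2 derive_cst addr0.
Qed.

(** A product with a factor that is flat at [p] is flat at [p] ([flat_atM]):
    this is how a test function is made invisible to all particles but those
    at a chosen position. *)
Definition flat_at (p : V) (g : V -> R) := g p = 0 /\ forall v, 'D_v g p = 0.

Lemma flat_atM p (g h : V -> R) : C1 g -> C1 h -> flat_at p h -> flat_at p (g * h).
Proof.
move=> gC hC [hp Dhp]; split=> [|v]; first by rewrite -[LHS]/(g p * h p) hp mulr0.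
rewrite (deriveM (C1_derivable _ p v gC) (C1_derivable _ p v hC)).
by rewrite hp Dhp scaler0 scale0r addr0.
Qed.

Lemma flat_at_sqr p (g : V -> R) : C1 g -> g p = 0 -> flat_at p (g * g).
Proof.
move=> gC gp; split=> [|v]; first by rewrite -[LHS]/(g p * g p) gp mulr0.
rewrite (deriveM (C1_derivable _ p v gC) (C1_derivable _ p v gC)).
by rewrite gp scale0r addr0.
Qed.

Lemma flat_atD p (g h : V -> R) :
  C1 g -> C1 h -> flat_at p g -> flat_at p h -> flat_at p (g + h).
Proof.
move=> gC hC [gp Dgp] [hp Dhp].
split=> [|v]; first by rewrite -[LHS]/(g p + h p) gp hp addr0.
rewrite (deriveD (C1_derivable _ p v gC) (C1_derivable _ p v hC)).
by rewrite Dgp Dhp addr0.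
Qed.

Lemma flat_at_sum p (I : finType) (g : I -> V -> R) :
  (forall i, C1 (g i)) -> (forall i, flat_at p (g i)) -> flat_at p (\sum_i g i).
Proof.
move=> gC gp; suff : C1 (\sum_i g i) /\ flat_at p (\sum_i g i) by case.
elim/big_rec : _ => [|i h _ [hC hp]].
  by split; [exact: C1_cst|split=> [//|v]; exact: derive_cst].
by split; [exact: C1D|exact: flat_atD].
Qed.

Definition sqdist (b : V) : V -> R :=
  \sum_(i < d1) xshift b i * xshift b i + \sum_(j < d2) cshift b j * cshift b j.

Lemma C1_sqdist b : C1 (sqdist b).
Proof.
by apply: C1D; apply: C1_sum => i; apply: C1M;
  by [exact: C1_xshift|exact: C1_cshift].
Qed.

Lemma flat_at_sqdist b : flat_at b (sqdist b).
Proof.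
apply: flat_atD; [| |apply: flat_at_sum => i|apply: flat_at_sum => j].
- by apply: C1_sum => i; apply: C1M; exact: C1_xshift.
- by apply: C1_sum => i; apply: C1M; exact: C1_cshift.
- by apply: C1M; exact: C1_xshift.
- by apply: flat_at_sqr; [exact: C1_xshift|exact: subrr].
- by apply: C1M; exact: C1_cshift.
- by apply: flat_at_sqr; [exact: C1_cshift|exact: subrr].
Qed.

Lemma sqdistE b p : sqdist b p =
  \sum_(i < d1) (p.1 ord0 i - b.1 ord0 i) ^+ 2 +
  \sum_(j < d2) (p.2 ord0 j - b.2 ord0 j) ^+ 2.
Proof. by rewrite -[LHS]/((_ : V -> R) p + (_ : V -> R) p) !fct_sumE. Qed.

Lemma sqdist_neq0 b p : p <> b -> sqdist b p != 0.
Proof.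
move=> pb; apply/eqP; rewrite sqdistE => /eqP.
have sq0 n (u v : 'rV[R]_n) : \sum_(i < n) (u ord0 i - v ord0 i) ^+ 2 == 0 -> u = v.
  rewrite psumr_eq0 => [/allP uv|i _]; last exact: sqr_ge0.
  apply/rowP => i; apply/eqP; rewrite -subr_eq0 -sqrf_eq0.
  by apply: uv; rewrite mem_index_enum.
rewrite paddr_eq0 ?sumr_ge0// => [/andP[/sq0 e1 /sq0 e2]| |] *.
- by apply: pb; move: p b e1 e2 => [p1 p2] [b1 b2] /= -> ->.
- exact: sqr_ge0.
- exact: sqr_ge0.
Qed.

(** The witness is the affine form [(w / Q(a)) . (x - x_a)] times the product
    [Q] of the squared Euclidean distances to the other positions: [Q] is flat
    at these positions, and at [pt a] the affine form vanishes, so that only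
    [Q(a)] times its gradient remains.  Particles at the position of [pt a] are
    left out of the product, and they see the same gradient. *)
Lemma grad_x_interpolation (I : finType) (pt : I -> V) (a : I) (w : 'rV[R]_d1) :
  exists phi, [/\ C1 phi, grad_x phi (pt a) = w &
    forall t, pt t <> pt a -> grad_x phi (pt t) = 0].
Proof.
pose Q := \prod_(t | pt t != pt a) sqdist (pt t).
have QC : C1 Q by apply: C1_prod => t; exact: C1_sqdist.
have Qa : Q (pt a) != 0.
  rewrite /Q; elim/big_rec : _ => [|t g ta ga]; first exact: oner_neq0.
  by rewrite mulf_neq0//; apply: sqdist_neq0 => /esym/eqP; exact/negP.
pose lin := \sum_(i < d1) (cst (w ord0 i / Q (pt a)) : V -> R) * xshift (pt a) i.
have linC : C1 lin.
  by apply: C1_sum => i; apply: C1M; [exact: C1_cst|exact: C1_xshift].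
exists (lin * Q); split.
- exact: C1M.
- apply/rowP => i; rewrite mxE.
  rewrite (deriveM (C1_derivable _ _ _ linC) (C1_derivable _ _ _ QC)).
  have -> : lin (pt a) = 0.
    rewrite /lin fct_sumE big1// => j _.
    by rewrite -[LHS]/(_ * (_ - _)) subrr mulr0.
  have lC j : C1 ((cst (w ord0 j / Q (pt a)) : V -> R) * xshift (pt a) j).
    by apply: C1M; [exact: C1_cst|exact: C1_xshift].
  rewrite scale0r add0r derive_sum => [|j]; last exact: C1_derivable.
  rewrite (bigD1 i)//= big1 ?addr0 => [|j ji].
    rewrite (deriveM (C1_derivable _ _ _ (C1_cst _)) (C1_derivable _ _ _ (C1_xshift _ _))).
    rewrite derive_cst derive_xshift scaler0 addr0 /= mxE !eqxx.
    by rewrite -[LHS]/(Q (pt a) * (w ord0 i / Q (pt a) * 1)) mulr1 mulrC divfK.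
  rewrite (deriveM (C1_derivable _ _ _ (C1_cst _)) (C1_derivable _ _ _ (C1_xshift _ _))).
  by rewrite derive_cst derive_xshift scaler0 addr0 /= mxE eqxx (negbTE ji) scaler0.
- move=> t ta; apply/rowP => i; rewrite !mxE.
  have [_ ->//] : flat_at (pt t) (lin * Q).
  apply: flat_atM => //; rewrite /Q (bigD1 t)/=; last exact/eqP.
  rewrite mulrC; apply: flat_atM; last exact: flat_at_sqdist.
    by apply: C1_prod => s; exact: C1_sqdist.
  exact: C1_sqdist.
Qed.

End C1Functions.

(** * Energy dissipation *)

(** Multiply the equilibrium at [a] by [w a * y a], sum over [a], and add the
    same identity with [a] and [b] exchanged: since [K] is symmetric, the result
    is minus [\sum_a \sum_b w a * w b * K a b * (y b - y a) ^+ 2].  All terms of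
    this nonnegative sum thus vanish. *)
Lemma energy_dissipation {R : realFieldType} (I : finType) (w y : I -> R)
    (K : I -> I -> R) :
  (forall a, 0 < w a) -> (forall a b, 0 <= K a b) ->
  (forall a b, K a b = K b a) ->
  (forall a, \sum_b w b * (K a b * (y b - y a)) = 0) ->
  forall a b, K a b = 0 \/ y a = y b.
Proof.
move=> w0 K0 KC eq0 a b.
have half : \sum_a \sum_b w a * w b * K a b * (y b - y a) * y a = 0.
  apply: big1 => s _.
  transitivity (w s * y s * \sum_t w t * (K s t * (y t - y s))).
    by rewrite mulr_sumr; apply: eq_bigr => t _; ring.
  by rewrite eq0 mulr0.
have half' : \sum_a \sum_b w a * w b * K a b * (y a - y b) * y b = 0.
  rewrite exchange_big -[RHS]half; apply: eq_bigr => s _; apply: eq_bigr => t _.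
  by rewrite (KC t s) (mulrC (w t)).
have tot : \sum_a \sum_b w a * w b * K a b * (y b - y a) ^+ 2 = 0.
  transitivity (- (\sum_a \sum_b w a * w b * K a b * (y b - y a) * y a +
                   \sum_a \sum_b w a * w b * K a b * (y a - y b) * y b)).
    rewrite -big_split -sumrN; apply: eq_bigr => s _.
    by rewrite -big_split -sumrN; apply: eq_bigr => t _ /=; ring.
  by rewrite half half' addr0 oppr0.
have t0 s t : 0 <= w s * w t * K s t * (y t - y s) ^+ 2.
  rewrite mulr_ge0 ?sqr_ge0//; apply: mulr_ge0 => //.
  by rewrite ltW// mulr_gt0.
have rowa := psumr_eq0P (fun s _ => sumr_ge0 _ (fun t _ => t0 s t)) tot (i := a) isT.
have := psumr_eq0P (fun t _ => t0 a t) rowa (i := b) isT.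
move/eqP; rewrite mulf_eq0 sqrf_eq0 subr_eq0 !mulf_eq0 !(gt_eqF (w0 _))/=.
by case/orP => /eqP->; [left|right].
Qed.

(** * Stationarity of an atomic distribution *)

Section AtomicMeanField.
Context {R : realType} {d1 d2 : nat}.
Variables (Omega : set ('rV[R]_d1 * 'rV[R]_d2)).
Variables (N1 : 'rV[R]_d1 -> R) (N2 : 'rV[R]_d2 -> R) (eps1 eps2 : R).
Variables (mode : interaction) (mu : {measure set (phase R d1 d2) -> \bar R}).
Context {I : finType} (w : I -> {posnum R}) (pt : I -> phase R d1 d2).
Hypothesis cOmega : compact Omega.
Hypothesis ptOmega : forall t, Omega (pt t).
Hypothesis norm1 : is_norm N1.
Hypothesis norm2 : is_norm N2.
Hypothesis eps1_ge0 : 0 <= eps1.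
Hypothesis eps2_ge0 : 0 <= eps2.
Hypothesis muE : forall A, measurable A ->
  mu A = (\sum_t (w t)%:num%:E * \d_(pt t) A)%E.

Local Notation K := (Defs.kernel N1 N2 eps1 eps2).
Local Notation sig := (Defs.sigma Omega N1 N2 eps1 eps2 mode mu).
Local Notation vel := (velocity Omega N1 N2 eps1 eps2 mode mu).

Let mOmega : measurable (Omega : set (phase R d1 d2)).
Proof. exact: compact_phase_measurable. Qed.

Lemma confidence_kernel_ge0 x c q : 0 <= K x c q.
Proof. by rewrite /Defs.kernel /chi; case: ifP; case: ifP; rewrite ?mulr1 ?mulr0. Qed.

Lemma confidence_kernel_self (p : phase R d1 d2) : K p.1 p.2 p = 1.
Proof.
by rewrite /Defs.kernel /chi !subrr (is_norm0 norm1) (is_norm0 norm2) eps1_ge0 eps2_ge0 mulr1.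
Qed.

Let mK x c : measurable_fun setT (K x c).
Proof. exact: measurable_confidence_kernel. Qed.

Lemma sigma_atomicE x c : sig x c =
  if mode is Symmetric then 1 else \sum_t (w t)%:num * K x c (pt t).
Proof.
rewrite /Defs.sigma; case: mode => //.
by rewrite (Rintegral_atomic _ _ _ muE)//; exact: measurable_funTS.
Qed.

Lemma velocity_atomicE x c i : vel x c ord0 i =
  \sum_t (w t)%:num * (K x c (pt t) / sig x c * ((pt t).1 - x) ord0 i).
Proof.
rewrite mxE (Rintegral_atomic _ _ _ muE)//; apply: measurable_funTS.
apply: measurable_funM; first by apply: measurable_funM.
apply: (eq_measurable_fun (fun q : phase R d1 d2 => q.1 ord0 i - x ord0 i)).
  by move=> q _; rewrite !mxE.
by apply: measurable_funB => //; exact: measurable_coord1.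
Qed.

(** A particle always interacts with itself. *)
Lemma sigma_atom_gt0 t : 0 < sig (pt t).1 (pt t).2.
Proof.
rewrite sigma_atomicE; case: mode => //.
rewrite (bigD1 t)//= confidence_kernel_self mulr1 ltr_pwDl//.
by apply: sumr_ge0 => s _; rewrite mulr_ge0// confidence_kernel_ge0.
Qed.

Lemma measurable_velocity i :
  measurable_fun setT (fun p : phase R d1 d2 => vel p.1 p.2 ord0 i).
Proof.
have mKt t : measurable_fun setT (fun p : phase R d1 d2 => K p.1 p.2 (pt t)).
  apply: (eq_measurable_fun (K (pt t).1 (pt t).2)) => // p _.
  exact: confidence_kernelC.
have msig : measurable_fun setT (fun p : phase R d1 d2 => sig p.1 p.2).
  under eq_fun do rewrite sigma_atomicE.
  case: mode; first exact: measurable_cst.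
  by apply: measurable_sum => t; apply: measurable_funM.
apply: (eq_measurable_fun (fun p : phase R d1 d2 => \sum_t (w t)%:num *
    (K p.1 p.2 (pt t) * (sig p.1 p.2)^-1 * ((pt t).1 ord0 i - p.1 ord0 i)))).
  move=> p _; rewrite velocity_atomicE; apply: eq_bigr => t _.
  by rewrite !mxE.
apply: measurable_sum => t; apply: measurable_funM => //.
apply: measurable_funM; last first.
  by apply: measurable_funB => //; exact: measurable_coord1.
apply: measurable_funM => //; exact: (measurableT_comp measurable_invr msig).
Qed.

(** The relative support is closed in the compact set Omega. *)
Lemma C1_test_function phi : C1 phi -> test_function Omega phi.
Proof.
move=> phiC; split=> //.
have clOmega : closed Omega.
  apply: compact_closed cOmega.
  exact: (@norm_hausdorff R ('rV[R]_d1 * 'rV[R]_d2)%type).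
apply: (subclosed_compact _ cOmega); first exact: closed_closure.
rewrite [X in _ `<=` X]((closure_id Omega).1 clOmega).
by apply: closure_subset; exact: subIsetl.
Qed.

Lemma weak_stationary_atomicE : weak_stationary Omega N1 N2 eps1 eps2 mode mu <->
  forall phi, C1 phi -> \sum_t (w t)%:num *
    \sum_(i < d1) vel (pt t).1 (pt t).2 ord0 i * grad_x phi (pt t) ord0 i = 0.
Proof.
have intE phi : C1 phi -> \int[mu]_(p in Omega)
    (\sum_(i < d1) vel p.1 p.2 ord0 i * grad_x phi p ord0 i) =
  \sum_t (w t)%:num *
    \sum_(i < d1) vel (pt t).1 (pt t).2 ord0 i * grad_x phi (pt t) ord0 i.
  move=> phiC; rewrite (Rintegral_atomic _ _ _ muE)//; apply: measurable_funTS.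
  apply: measurable_sum => i; apply: measurable_funM.
    exact: measurable_velocity.
  apply: (eq_measurable_fun ('D_(delta_mx ord0 i, 0) phi : phase R d1 d2 -> R)).
    by move=> p _; rewrite mxE.
  by apply: continuous_phase_measurable; exact: phiC.2.
split=> [stat phi phiC|stat phi [phiC _]].
  by apply: oppr_inj; rewrite oppr0 -intE//; apply/stat/C1_test_function.
by rewrite intE// stat// oppr0.
Qed.

(** With a test function whose gradient is the velocity [v] at [pt a] and 0 at
    the other positions, the weak equation is [v . v] times the total weight
    of the particles located at [pt a]. *)
Lemma velocity_eq0_of_stationary :
  weak_stationary Omega N1 N2 eps1 eps2 mode mu ->
  forall t, vel (pt t).1 (pt t).2 = 0.
Proof.
move=> /weak_stationary_atomicE stat a; set v := vel _ _.
have [phi [phiC grada grad0]] := grad_x_interpolation _ pt a v.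
pose F t := (w t)%:num *
  \sum_(i < d1) vel (pt t).1 (pt t).2 ord0 i * grad_x phi (pt t) ord0 i.
have Fa t : pt t = pt a -> F t = (w t)%:num * \sum_(i < d1) v ord0 i ^+ 2.
  by move=> ta; rewrite /F ta grada; congr (_ * _); apply: eq_bigr => i _; rewrite expr2.
have F0 t : 0 <= F t.
  have [/eqP ta|/eqP ta] := boolP (pt t == pt a).
    by rewrite Fa// mulr_ge0// sumr_ge0// => i _; exact: sqr_ge0.
  by rewrite /F grad0// big1 ?mulr0// => i _; rewrite [X in _ * X]mxE mulr0.
have := psumr_eq0P (fun t _ => F0 t) (stat phi phiC) (i := a) isT.
move/eqP; rewrite Fa// mulf_eq0 gt_eqF//= psumr_eq0 => [/allP v0|i _]; last exact: sqr_ge0.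
apply/rowP => i; apply/eqP; rewrite [eqbRHS]mxE -sqrf_eq0.
by apply: v0; rewrite mem_index_enum.
Qed.

(** A stationary distribution has zero velocity at each particle; multiplied by
    the positive sigma, this is the equilibrium hypothesis of
    [energy_dissipation], used on one opinion coordinate at a time. *)
Lemma weak_stationary_atomicP : weak_stationary Omega N1 N2 eps1 eps2 mode mu <->
  forall s t, K (pt s).1 (pt s).2 (pt t) = 0 \/ (pt s).1 = (pt t).1.
Proof.
split=> [stat s t|indep].
  have [->|/eqP Kst] := eqVneq (K (pt s).1 (pt s).2 (pt t)) 0; first by left.
  right; apply/rowP => i.
  have := @energy_dissipation R I (fun t => (w t)%:num) (fun t => (pt t).1 ord0 i)
    (fun s t => K (pt s).1 (pt s).2 (pt t)).
  case/(_ _ _ _ _ s t) => // [a b|a b|a].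
  - exact: confidence_kernel_ge0.
  - exact: confidence_kernelC.
  - have := velocity_eq0_of_stationary stat a => /rowP/(_ i).
    rewrite velocity_atomicE mxE => Va.
    have s0 := lt0r_neq0 (sigma_atom_gt0 a).
    rewrite -[RHS](mulr0 (sig (pt a).1 (pt a).2)) -[X in _ = _ * X]Va mulr_sumr.
    by apply: eq_bigr => b _; rewrite !mxE; field.
apply/weak_stationary_atomicE => phi _; apply: big1 => t _.
rewrite big1 ?mulr0// => i _; rewrite velocity_atomicE big1 ?mul0r// => s _.
by case: (indep t s) => [->|->]; rewrite ?subrr ?mxE ?mul0r !mulr0.
Qed.

End AtomicMeanField.

(** * The theorem *)

Theorem lemma3p3 (R : realType) (d1 d2 : nat)
    (Omega1 : set 'rV[R]_d1) (Omega2 : set 'rV[R]_d2)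
    (compact_Omega1 : compact Omega1) (compact_Omega2 : compact Omega2)
    (N1 : 'rV[R]_d1 -> R) (N2 : 'rV[R]_d2 -> R)
    (norm_N1 : is_norm N1) (norm_N2 : is_norm N2)
    (mode : interaction)
    (n1 : nat) (n2 : 'I_n1 -> nat)
    (n1_ge1 : (1 <= n1)%N) (n2_ge1 : forall k : 'I_n1, (1 <= n2 k)%N)
    (x : 'I_n1 -> 'rV[R]_d1) (c : forall k : 'I_n1, 'I_(n2 k) -> 'rV[R]_d2)
    (x_in : forall k, Omega1 (x k)) (c_in : forall k l, Omega2 (c k l))
    (x_distinct : forall i k : 'I_n1, i <> k -> x i <> x k)
    (f : 'I_n1 -> {posnum R})
    (f_sum1 : \sum_(k < n1) \sum_(l < n2 k) (f k)%:num = 1)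
    (eps1 eps2 : R) (eps1_gt0 : 0 < eps1) (eps2_gt0 : 0 < eps2) :
  weak_stationary (Omega1 `*` Omega2) N1 N2 eps1 eps2 mode
    (opinion_clusters x c f) <->
  (forall i k : 'I_n1, i <> k ->
     (eps1 < N1 (x i - x k)) \/
     (forall (j : 'I_(n2 i)) (l : 'I_(n2 k)), eps2 < N2 (c i j - c k l))).
Proof.
have cO : compact (Omega1 `*` Omega2) by exact: compact_setX.
have pO (t : {k : 'I_n1 & 'I_(n2 k)}) : (Omega1 `*` Omega2) (position x c t).
  by split; [exact: x_in|exact: c_in].
have muE A := fun _ : measurable A => opinion_clustersE x c f A.
apply: (iff_trans (weak_stationary_atomicP _ _ _ _ _ mode _ _ _ cO pO norm_N1 norm_N2
  (ltW eps1_gt0) (ltW eps2_gt0) muE)).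
have kE i k (j : 'I_(n2 i)) (l : 'I_(n2 k)) :
    Defs.kernel N1 N2 eps1 eps2 (x i) (c i j) (point_of (x k) (c k l)) = 0 <->
    eps1 < N1 (x i - x k) \/ eps2 < N2 (c i j - c k l).
  rewrite /Defs.kernel /chi /= (is_norm_distC norm_N1) (is_norm_distC norm_N2).
  case: leP => h1; case: leP => h2; rewrite ?mulr1 ?mulr0; split=> //;
    by [move/eqP; rewrite oner_eq0|case|left|right].
split=> [indep i k ik|sep s t].
(* Two interacting members, one in each cluster, would force [x i = x k]. *)
- case: (ltP eps1 (N1 (x i - x k))) => h1; [by left|right] => j l.
  case: (indep (Tagged _ j) (Tagged _ l)) => /=; last by move/x_distinct: ik.
  by move/kE => [|//]; rewrite ltNge h1.
- have [st|/eqP st] := eqVneq (tag s) (tag t).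
    by right; rewrite /= st.
  by left; apply/kE; case: (sep _ _ st) => h; [left|right].
Qed.
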